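(* Let $G$ be a chordal graph with perfect elimination order $v_1,\ldots,v_n$, and for $0\le m\le n$ let $G_m$ be the subgraph of $G$ induced by $v_1,\ldots,v_m$. Then the matrix $S_G=\left[{G_m \brace k}\right]_{m,k=0}^n$ is totally non-negative.
   Context: A graph is chordal if it contains no induced cycle of length four or more. An ordering $v_1,\ldots,v_n$ of the vertices is a perfect elimination order if for each $m$ the neighbours of $v_m$ among $v_1,\ldots,v_{m-1}$ form a clique. For a graph $H$ and integer $k$, ${H \brace k}$ is the number of partitions of the vertex set of $H$ into $k$ non-empty independent sets. A matrix is totally non-negative if all its minors are non-negative. *)

(* Defs.v *)
From mathcomp Require Import all_boot all_order all_algebra.

Set Implicit Arguments.
Unset Strict Implicit.
Unset Printing Implicit Defensive.

Import Order.TTheory GRing.Theory Num.Theory.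

Record sgraph := SGraph {
  vertex :> finType;
  adj : rel vertex;
  adj_sym : symmetric adj;
  adj_irrefl : irreflexive adj }.

Section Graphs.
Variable G : sgraph.
Implicit Types (A S : {set G}).

Definition clique S : bool :=
  [forall x in S, forall y in S, (x != y) ==> adj x y].

Definition independent S : bool :=
  [forall x in S, forall y in S, ~~ adj x y].

Definition induced_adj A : rel {x : G | x \in A} :=
  fun x y => adj (val x) (val y).

Lemma induced_adj_sym A : symmetric (@induced_adj A).
Proof. by move=> x y; apply: adj_sym. Qed.

Lemma induced_adj_irrefl A : irreflexive (@induced_adj A).
Proof. by move=> x; apply: adj_irrefl. Qed.

Definition induced A : sgraph :=
  SGraph (@induced_adj_sym A) (@induced_adj_irrefl A).

(* [c] lists the vertices of a cycle cyclically ([ordS] is the successor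
   modulo [k]); the equality for all pairs says that the cycle is chordless.
   Meaningful for [k >= 3]. *)
Definition induced_cycle (k : nat) (c : 'I_k -> G) : Prop :=
  injective c /\
  forall i j : 'I_k, adj (c i) (c j) = (j == ordS i) || (i == ordS j).

Definition chordal : Prop :=
  forall (k : nat) (c : 'I_k -> G), 4 <= k -> ~ induced_cycle c.

(* An ordering [v_1, ..., v_n] of the vertices is a bijection [v] from ['I_n],
   with [v_m] being [v] at [m - 1]. *)
Definition perfect_elimination_order (n : nat) (v : 'I_n -> G) : Prop :=
  bijective v /\
  forall m : 'I_n, clique [set v i | i : 'I_n & (i < m) && adj (v m) (v i)].

Definition initial_segment (n : nat) (v : 'I_n -> G) (m : nat) : {set G} :=
  [set v i | i : 'I_n & i < m].

Definition graph_stirling (k : nat) : nat :=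
  #|[set P : {set {set G}} | [&& partition P [set: G],
       [forall B in P, independent B] & #|P| == k]]|.

End Graphs.

Definition stirling_matrix (G : sgraph) (n : nat) (v : 'I_n -> G) :
    'M[int]_n.+1 :=
  \matrix_(m, k) Posz (graph_stirling (induced (initial_segment v m)) k).

(* Minors are taken with rows and columns in increasing order. *)
Definition totally_nonneg (R : numDomainType) (p q : nat)
    (A : 'M[R]_(p, q)) : Prop :=
  forall (k : nat) (f : 'I_k -> 'I_p) (g : 'I_k -> 'I_q),
    {homo f : i j / i < j} -> {homo g : i j / i < j} ->
    (0 <= \det (mxsub f g A))%R.

(* Main.v *)
Require Import Defs.
From mathcomp Require Import all_boot all_order all_algebra.
From mathcomp Require Import zify ring.

(** Adding a vertex with [d] pairwise adjacent neighbours turns [S k] into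
    [S k.-1 + (k - d) * S k]; so row [m] of the matrix lists the coefficients
    of [prod_(i < m) (x - d_i)] in the basis of falling factorials, where [d_i]
    is the number of earlier neighbours of the [i]-th vertex.  Each row
    operation "add a nonnegative multiple of row [i - 1] to row [i]" preserves
    total nonnegativity, and two moves on the sequence [d] have that effect:
    exchanging an adjacent pair [q, p] into [p, q] when [p <= q], and lowering
    the last term.  As the earlier neighbours of a vertex form a clique,
    [d_m] is at most one more than some earlier term (or 0), and a sequence
    with this property can be reached by such moves from [0, 1, ..., n - 1],
    whose matrix is the identity. *)

Set Implicit Arguments.
Unset Strict Implicit.
Unset Printing Implicit Defensive.

Import Order.TTheory GRing.Theory Num.Theory.

(** * Total nonnegativity: identity matrix and row operations *)

Section TotalNonnegativity.
Local Open Scope ring_scope.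

(** If [f] and [g] first differ at [i], the smaller of [f i] and [g i] is missed by the other map,
    so the minor has a zero row or column; if they agree, the submatrix is again an identity. *)
Lemma totally_nonneg_id (R : numDomainType) (p : nat) :
  totally_nonneg (1%:M : 'M[R]_p).
Proof.
move=> k f g f_incr g_incr.
have monoP (h : 'I_k -> 'I_p) : {homo h : i j / (i < j)%N} ->
    forall i j : 'I_k, (i <= j)%N -> (h i <= h j)%N.
  by move=> h_incr i j; rewrite leq_eqVlt => /predU1P[/ord_inj->//|/h_incr/ltnW].
have key (f1 g1 : 'I_k -> 'I_p) (i : 'I_k) :
    {homo f1 : i j / (i < j)%N} -> {homo g1 : i j / (i < j)%N} ->
    (forall j : 'I_k, (j < i)%N -> f1 j = g1 j) -> (f1 i < g1 i)%N ->
    forall j, f1 i != g1 j.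
  move=> f1_incr g1_incr eq_fg lt_fg j; apply/eqP => eq_ij.
  have [lt_ji|le_ij] := ltnP j i.
    by have := f1_incr _ _ lt_ji; rewrite eq_fg // eq_ij ltnn.
  by have := monoP _ g1_incr _ _ le_ij; rewrite -eq_ij leqNgt lt_fg.
have [/forallP eq_fg|] := boolP [forall i, f i == g i].
  rewrite (_ : mxsub f g _ = 1%:M) ?det1 //; apply/matrixP => i j.
  rewrite !mxE (eqP (eq_fg i)); congr (_ %:R); apply/esym.
  case: (ltngtP i j) => [lt_ij|lt_ji|/ord_inj->]; last by rewrite !eqxx.
    by rewrite -!val_eqE !ltn_eqF ?g_incr.
  by rewrite -!val_eqE !gtn_eqF ?g_incr.
rewrite negb_forall => /existsP[i0 neq_i0].
case: (arg_minnP (P := [pred i | f i != g i]) val neq_i0) => i /= neq_i min_i.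
have eq_fg (j : 'I_k) : (j < i)%N -> f j = g j.
  by move=> lt_ji; apply/eqP; apply: contraTT lt_ji => /min_i; rewrite -leqNgt.
have eq_gf (j : 'I_k) : (j < i)%N -> g j = f j by move=> /eq_fg.
move: neq_i; rewrite -val_eqE neq_ltn => /orP[] lt_i.
  rewrite (expand_det_row _ i) big1 // => j _.
  by rewrite !mxE (negPf (key _ _ _ f_incr g_incr eq_fg lt_i j)) mul0r.
rewrite (expand_det_col _ i) big1 // => j _.
by rewrite !mxE eq_sym (negPf (key _ _ _ g_incr f_incr eq_gf lt_i j)) mul0r.
Qed.

(** By linearity in row [i], a minor of [F] using that row is a minor of [F'] plus [c] times the
    determinant with row [i.-1] in place of row [i]. The latter vanishes if row [i.-1] was already
    chosen; otherwise the choice of rows stays increasing, since [i.-1] and [i] are consecutive. *)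
Lemma totally_nonneg_addrow (R : numDomainType) (p q i : nat) (c : R)
    (F F' : nat -> nat -> R) :
  0 <= c -> (0 < i)%N ->
  (forall m k, (m < p)%N ->
    F m k = F' m k + (if m == i then c * F' i.-1 k else 0)) ->
  totally_nonneg (\matrix_(m < p, k < q) F' m k) ->
  totally_nonneg (\matrix_(m < p, k < q) F m k).
Proof.
move=> c_ge0 i_gt0 FE tnF' k f g f_incr g_incr.
have [/existsP[j /eqP fj]|] := boolP [exists j, f j == i :> nat]; last first.
  rewrite negb_exists => /forallP f_neq.
  rewrite (_ : mxsub f g _ = mxsub f g (\matrix_(m, k) F' m k)) ?tnF' //.
  by apply/matrixP => a b; rewrite !mxE FE // (negPf (f_neq a)) addr0.
have lt_i : (i.-1 < p)%N by rewrite (leq_ltn_trans (leq_pred _)) // -fj ltn_ord.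
pose f' a := if a == j then Ordinal lt_i else f a.
have f_inj a b : f a = f b -> a = b.
  by move=> eq_f; case: (ltngtP a b) => [/f_incr|/f_incr|/ord_inj//];
     rewrite eq_f ltnn.
rewrite (@determinant_multilinear _ _ _ (mxsub f g (\matrix_(m, k) F' m k))
  (mxsub f' g (\matrix_(m, k) F' m k)) j 1 c).
- rewrite mul1r addr_ge0 ?tnF' // mulr_ge0 //.
  have [/existsP[a /eqP fa]|] := boolP [exists a, f a == i.-1 :> nat].
    have neq_aj : a != j by apply/eqP => eq_aj; move: fa; rewrite eq_aj fj; lia.
    rewrite (determinant_alternate neq_aj) // => b.
    by rewrite !mxE /f' (negPf neq_aj) eqxx /= fa.
  rewrite negb_exists => /forallP f_neq; apply: tnF' => // a b lt_ab.
  have := f_incr _ _ lt_ab; have := f_neq a; rewrite /f'.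
  case: (a =P j) => [eq_a|_]; case: (b =P j) => [eq_b|_] //=.
  - by move: lt_ab; rewrite eq_a eq_b ltnn.
  - by rewrite eq_a fj; lia.
  - by rewrite eq_b fj; lia.
- by apply/rowP => b; rewrite !mxE /f' eqxx FE // fj eqxx mul1r.
- by apply/matrixP => a b; rewrite !mxE FE // -fj val_eqE (inj_eq f_inj)
     eq_sym (negPf (neq_lift _ _)) addr0.
- apply/matrixP => a b; rewrite !mxE FE // -fj val_eqE (inj_eq f_inj) /f'.
  by rewrite eq_sym (negPf (neq_lift _ _)) addr0.
Qed.

End TotalNonnegativity.

(** * Products of linear factors in the falling factorial basis *)

Section FactorialExpansion.
Local Open Scope ring_scope.

(* [f] holds the coefficients of a polynomial in the basis
   [x (x - 1) ... (x - k + 1)]; the result holds those of its product with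
   [x - p], by [x * x^_k = x^_k.+1 + k * x^_k]. *)
Definition mul_root (f : nat -> int) (p k : nat) : int :=
  (if k is k'.+1 then f k' else 0) + (k%:Z - p%:Z) * f k.

Definition expansion (e : seq nat) : nat -> int :=
  foldl mul_root (fun k => (k == 0)%N%:R) e.

Lemma eq_foldl_mul_root e f g :
  f =1 g -> foldl mul_root f e =1 foldl mul_root g e.
Proof.
elim: e f g => //= p e IHe f g eq_fg; apply: IHe => k.
by rewrite /mul_root !eq_fg; case: k => [|k]; rewrite ?eq_fg.
Qed.

Lemma mul_rootC f p q : mul_root (mul_root f p) q =1 mul_root (mul_root f q) p.
Proof. by move=> [|[|k]]; rewrite /mul_root; ring. Qed.

Lemma expansion_rcons e p : expansion (rcons e p) = mul_root (expansion e) p.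
Proof. by rewrite /expansion foldl_rcons. Qed.

(** This is [x - p = (x - q) + (q - p)], the source of the row operations below. *)
Lemma mul_root_shift f p q k :
  mul_root f p k = mul_root f q k + (q%:Z - p%:Z) * f k.
Proof. by rewrite /mul_root; ring. Qed.

(** The product [x (x - 1) ... (x - n + 1)] is itself a basis element. *)
Lemma expansion_iota n k : expansion (iota 0 n) k = (k == n)%:R.
Proof.
elim: n k => [//|n IHn] k.
rewrite -addn1 iotaD cats1 expansion_rcons /mul_root !IHn add0n.
case: k => [|k]; rewrite ?IHn ?addn1 ?eqSS.
  by case: n {IHn} => [|n] /=; rewrite ?mulr0 ?mulr1.
by case: (k.+1 =P n) => [->|_]; rewrite ?subrr ?mul0r ?mulr0 addr0.
Qed.

Definition tn_expansion (n : nat) (e : seq nat) :=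
  totally_nonneg (\matrix_(m < n.+1, k < n.+1) expansion (take m e) k).

Lemma tn_expansion_iota n : tn_expansion n (iota 0 n).
Proof.
rewrite /tn_expansion (_ : \matrix_(_, _) _ = 1%:M).
  exact: totally_nonneg_id.
apply/matrixP => m k; rewrite !mxE take_iota (minn_idPl _) -1?ltnS //.
by rewrite expansion_iota eq_sym.
Qed.

(** The two products agree in every row except [(size s).+1], where they differ by [q - p] times the
    row of [s]. *)
Lemma tn_expansion_swap n s p q t : (p <= q)%N ->
  tn_expansion n (s ++ q :: p :: t) -> tn_expansion n (s ++ p :: q :: t).
Proof.
move=> le_pq; apply: (@totally_nonneg_addrow _ _ _ (size s).+1 (q%:Z - p%:Z)
  (fun m => expansion (take m (s ++ p :: q :: t)))
  (fun m => expansion (take m (s ++ q :: p :: t)))) => //.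
  by rewrite subr_ge0.
move=> m k _; rewrite /=.
case: (ltngtP m (size s).+1) => [lt_m|gt_m|->].
- by rewrite !takel_cat // addr0.
- rewrite addr0 !take_cat ltnNge (ltnW (ltnW gt_m)) /=.
  (* Here [m - size s] is at least 2, so the prefix contains both exchanged factors, which
     commute. *)
  case: (m - size s)%N (leq_sub2r (size s) gt_m) => [|[|a]]; [lia|lia|move=> _].
  by rewrite /expansion !foldl_cat /=; apply: eq_foldl_mul_root => j; apply: mul_rootC.
- rewrite (take_size_cat _ (erefl (size s)));
  rewrite !take_cat !ltnNge !leqnSn !subSnn /= !cats1 !expansion_rcons.
  exact: mul_root_shift.
Qed.

(** Only row [n] involves the last term, and row [n.-1] is the expansion of [s]. *)
Lemma tn_expansion_raise n s p q : size s = n.-1 -> (0 < n)%N -> (p <= q)%N ->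
  tn_expansion n (rcons s q) -> tn_expansion n (rcons s p).
Proof.
move=> size_s n_gt0 le_pq.
apply: (@totally_nonneg_addrow _ _ _ n (q%:Z - p%:Z)
  (fun m => expansion (take m (rcons s p)))
  (fun m => expansion (take m (rcons s q)))) => //.
  by rewrite subr_ge0.
move=> m k lt_m; rewrite -!cats1 (take_size_cat _ size_s).
case: eqP => [->|neq_m]; last by rewrite !takel_cat ?addr0 // size_s; lia.
rewrite !take_oversize ?size_cat ?size_s ?addn1 ?prednK // !cats1 !expansion_rcons.
exact: mul_root_shift.
Qed.

Lemma tn_expansion_bubble n s r q t : all (leq^~ q) r ->
  tn_expansion n (s ++ q :: r ++ t) -> tn_expansion n (s ++ r ++ q :: t).
Proof.
elim: r s => [//|x r IHr] s /= /andP[le_xq le_rq] tn_e.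
rewrite -cat_rcons; apply: IHr => //; rewrite cat_rcons.
exact: tn_expansion_swap.
Qed.

(* [j] is one more than the largest term seen so far. *)
Fixpoint restricted_growth (j : nat) (r : seq nat) : bool :=
  if r is x :: r' then (x <= j)%N && restricted_growth (maxn j x.+1) r' else true.

(** The bound can rise above [j] only through a term equal to [j]. *)
Lemma restricted_growth_notin j r :
  restricted_growth j r -> j \notin r -> all (ltn^~ j) r.
Proof.
elim: r => [//|x r IHr] /= /andP[le_xj rg_r]; rewrite inE negb_or.
case/andP=> neq_jx j_r; have lt_xj : (x < j)%N by lia.
by rewrite lt_xj; move: rg_r; rewrite (maxn_idPl lt_xj) => /IHr->.
Qed.

Lemma restricted_growth_catl j s r :
  restricted_growth j (s ++ r) -> restricted_growth j s.
Proof. by elim: s j => [//|x s IHs] j /= /andP[-> /IHs]. Qed.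

Lemma restricted_growth_cat j s r : all (ltn^~ j) s ->
  restricted_growth j (s ++ r) = restricted_growth j r.
Proof.
elim: s => [//|x s IHs] /= /andP[lt_xj lt_s].
by rewrite (maxn_idPl lt_xj) ltnW // IHs.
Qed.

(** Induction on the size of [r], each stage absorbing one term [j] into the initial run
    [iota 0 j]. *)
Lemma tn_expansion_restricted_growth n j r :
  size (iota 0 j ++ r) = n -> restricted_growth j r ->
  tn_expansion n (iota 0 j ++ r).
Proof.
move En: (size r) => m; elim: m j r En => [|m IHm] j r.
  move=> /size0nil-> <- _; rewrite cats0 size_iota; exact: tn_expansion_iota.
(* The sequence comes from [iota 0 j.+1 ++ s ++ t], to which the induction applies, by moving [j]
   right past the smaller terms of [s]. *)
have step s t : (size (s ++ t) = m)%N -> size (iota 0 j ++ s ++ j :: t) = n ->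
    all (ltn^~ j) s -> restricted_growth j.+1 t ->
    tn_expansion n (iota 0 j ++ s ++ j :: t).
  move=> size_st size_e lt_s rg_t; apply: tn_expansion_bubble.
    by apply: sub_all lt_s => x /ltnW.
  rewrite -cat_rcons -cats1 -[[:: j]]/(iota (0 + j) 1) -iotaD addn1.
  apply: IHm => //.
    by rewrite -size_e !size_cat !size_iota /=; lia.
  by rewrite restricted_growth_cat //; apply: sub_all lt_s => x /ltnW.
move=> size_r size_e rg_r.
have [j_r|j_r] := boolP (j \in r).
  pose s := take (index j r) r; pose t := drop (index j r).+1 r.
  have rE : r = s ++ j :: t.
    by rewrite -{1}(cat_take_drop (index j r) r) (drop_nth j) ?index_mem ?nth_index.
  have j_s : j \notin s by rewrite in_take_leq ?ltnn // index_size.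
  have lt_s : all (ltn^~ j) s.
    by apply: restricted_growth_notin j_s; move: rg_r; rewrite rE => /restricted_growth_catl.
  rewrite rE in size_r size_e rg_r *; apply: step => //.
    by move: size_r; rewrite !size_cat /= addnS => -[].
  by move: rg_r; rewrite restricted_growth_cat //= leqnn (maxn_idPr (leqnSn j)).
(* Without a [j] in [r], all terms are below [j]: the last one is raised to [j], and [step] applies
   with empty [t]. *)
have lt_r := restricted_growth_notin rg_r j_r.
case/lastP: r size_r size_e lt_r {j_r rg_r} => [//|s p] size_r size_e.
rewrite all_rcons => /andP[lt_pj lt_s].
rewrite -rcons_cat; apply: (@tn_expansion_raise _ _ _ j); last 1 first.
- rewrite -cats1 -catA; apply: step => //.
    by move: size_r; rewrite size_rcons cats0 => -[].
  by rewrite -size_e !size_cat size_rcons addn1.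
- by rewrite -size_e !size_cat size_rcons addnS.
- by rewrite -size_e !size_cat size_rcons addnS.
- exact: ltnW.
Qed.

End FactorialExpansion.

(** * Independent sets and cliques *)

Section Independence.
Variable G : sgraph.
Implicit Types (A B : {set G}) (x : G).

Lemma independentP A :
  reflect {in A &, forall x y, ~~ adj x y} (independent A).
Proof.
apply: (iffP forall_inP) => [A_ind x y Ax Ay|A_ind x Ax].
  exact: forall_inP (A_ind x Ax) y Ay.
by apply/forall_inP => y; apply: A_ind.
Qed.

Lemma cliqueP A :
  reflect {in A &, forall x y, x != y -> adj x y} (clique A).
Proof.
apply: (iffP forall_inP) => [A_cl x y Ax Ay|A_cl x Ax].
  exact/implyP/(forall_inP (A_cl x Ax) y Ay).
by apply/forall_inP => y Ay; apply/implyP; apply: A_cl.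
Qed.

Lemma independent_sub A B : A \subset B -> independent B -> independent A.
Proof.
move=> /subsetP sAB /independentP B_ind; apply/independentP => x y Ax Ay.
by apply: B_ind; apply: sAB.
Qed.

Lemma independent1 x : independent [set x].
Proof. by apply/independentP => y z /set1P-> /set1P->; rewrite adj_irrefl. Qed.

Lemma independentU1 x A :
  independent (x |: A) = independent A && [forall y in A, ~~ adj x y].
Proof.
apply/idP/andP => [xA_ind|[/independentP A_ind /forall_inP x_ind]].
  split; first by apply: independent_sub xA_ind; apply: subsetUr.
  apply/forall_inP => y Ay; apply: (independentP _ xA_ind).
    exact: setU11.
  exact: setU1r.
apply/independentP => y z /setU1P[->|Ay] /setU1P[->|Az].
- by rewrite adj_irrefl.
- exact: x_ind.
- by rewrite adj_sym x_ind.
- exact: A_ind.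
Qed.

End Independence.

(** * Counting partitions into independent sets when a vertex is added *)

Section StablePartitions.
Variable G : sgraph.
Implicit Types (A B : {set G}) (x : G) (P : {set {set G}}).

(** Blocks are sets of vertices of [G] itself, so that no change of type occurs when [A] grows. *)
Definition stable_partitions A (k : nat) : {set {set {set G}}} :=
  [set P | [&& partition P A, [forall B in P, independent B] & #|P| == k]].

Lemma stable_partitionsP A k P :
  reflect [/\ partition P A, {in P, forall B, independent B} & #|P| = k]
          (P \in stable_partitions A k).
Proof.
rewrite inE; apply: (iffP and3P) => [[P_A /forall_inP P_ind /eqP P_k]|] //.
by case=> P_A P_ind /eqP P_k; split=> //; apply/forall_inP.
Qed.

Lemma graph_stirling_induced A k :
  graph_stirling (induced A) k = #|stable_partitions A k|.
Proof.
pose up (B : {set induced A}) : {set G} := [set val y | y in B].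
have up_inj : injective up by apply: imset_inj; apply: val_inj.
rewrite /graph_stirling -(card_imset _ (imset_inj up_inj)).
have up_ind (B : {set induced A}) : independent (up B) = independent B.
  apply/independentP/independentP => B_ind y z.
    by move=> By Bz; apply: (B_ind (val y) (val z)); apply: imset_f.
  by move=> /imsetP[y' By ->] /imsetP[z' Bz ->]; apply: (B_ind y' z').
have up_setT : up setT = A.
  apply/setP => y; apply/imsetP/idP => [[z _ ->]|Ay]; first exact: valP.
  by exists (exist _ y Ay).
have up_stable (P : {set {set induced A}}) : (up @: P \in stable_partitions A k) =
    [&& partition P [set: induced A], [forall B in P, independent B] & #|P| == k].
  rewrite inE card_imset // -[X in partition _ X]up_setT (imset_partition _ _ val_inj).
  congr [&& _, _ & _]; apply/forall_inP/forall_inP => P_ind B PB.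
    by rewrite -up_ind; apply/P_ind/imset_f.
  by case/imsetP: PB => C PC ->; rewrite up_ind P_ind.
congr #|pred_of_set _|; apply/setP => Q; apply/imsetP/idP => [[P P_st ->]|Q_st].
  by rewrite up_stable; move: P_st; rewrite inE.
pose P := [set val @^-1: B | B : {set G} in Q] : {set {set induced A}}.
suff QE : Q = up @: P by exists P; rewrite // inE -up_stable -QE.
have [Q_A _ _] := stable_partitionsP _ _ _ Q_st.
rewrite -imset_comp -[LHS]imset_id; apply: eq_in_imset => B QB /=.
apply/setP => y; apply/idP/imsetP => [By|[z]]; last by rewrite inE => ? ->.
have Ay : y \in A by apply: subsetP (partitionS Q_A QB) _ By.
by exists (exist _ y Ay); rewrite ?inE.
Qed.

(** The neighbours of [x] form a clique, so they occupy [#|N|] distinct blocks, and these are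
    exactly the blocks that [x] cannot join. *)
Lemma card_free_blocks A k P x
    (N : {set G} := [set y in A | adj x y]) :
  clique N -> P \in stable_partitions A k ->
  #|[set B in P | independent (x |: B)]| + #|N| = k.
Proof.
move=> /cliqueP N_cl /stable_partitionsP[P_A P_ind <-].
have P_triv := partition_trivIset P_A.
have N_cover y : y \in N -> y \in cover P.
  by rewrite (cover_partition P_A) inE => /andP[].
have pblock_inj : {in N &, injective (pblock P)}.
  move=> y z Ny Nz eq_yz; apply: contraTeq isT => neq_yz.
  have PB := pblock_mem (N_cover y Ny).
  have := independentP _ (P_ind _ PB) y z.
  rewrite mem_pblock N_cover // eq_yz mem_pblock N_cover // => /(_ isT isT).
  by rewrite N_cl.
rewrite -(card_in_imset pblock_inj) -[RHS](cardsID [set B | independent (x |: B)]).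
congr (_ + _); apply: eq_card => B; first by rewrite !inE.
apply/imsetP/setDP => [[y Ny ->]|[PB]].
  rewrite pblock_mem ?N_cover //; split=> //.
  rewrite inE independentU1 negb_and; apply/orP; right.
  rewrite negb_forall; apply/existsP; exists y.
  by rewrite mem_pblock N_cover //; move: Ny; rewrite inE => /andP[_ ->].
rewrite inE independentU1 P_ind //= negb_forall => /existsP[y].
rewrite negb_imply negbK => /andP[By adj_xy]; exists y.
  by rewrite inE adj_xy andbT; apply: subsetP (partitionS P_A PB) _ By.
by rewrite (def_pblock P_triv PB By).
Qed.

(** Deleting or adjoining the block [[set x]] gives the bijection. *)
Lemma stable_partitions_singleton A k x : x \notin A ->
  #|stable_partitions (x |: A) k :&: [set P : {set {set G}} | [set x] \in P]| =
  if k is k'.+1 then #|stable_partitions A k'| else 0.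
Proof.
move=> A'x; have dis_xA : [disjoint [set x] & A] by rewrite disjoints1.
have xAx : (x |: A) :\ x = A by rewrite setU1K.
case: k => [|k].
  apply: eq_card0 => P; rewrite inE; apply/negP => /andP[].
  by case/stable_partitionsP => _ _ /cards0_eq->; rewrite !inE.
have notin P : P \in stable_partitions A k -> [set x] \notin P.
  case/stable_partitionsP => P_A _ _; apply: contra A'x => Px.
  by apply: subsetP (partitionS P_A Px) _ _; apply: set11.
have inj : {in stable_partitions A k &, injective (fun P : {set {set G}} => [set x] |: P)}.
  by move=> P Q P_st Q_st eq_PQ; rewrite -(setU1K (notin P P_st)) eq_PQ setU1K ?notin.
rewrite -(card_in_imset inj); apply: eq_card => P.
apply/setIP/imsetP => [[/stable_partitionsP[P_A P_ind P_k]]|[Q Q_st ->]].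
  rewrite inE => Px; exists (P :\ [set x]); last by rewrite setD1K.
  apply/stable_partitionsP; split.
  - by rewrite -[X in partition _ X]xAx; apply: partitionD1.
  - by move=> B /setD1P[_ /P_ind].
  - by move: P_k; rewrite (cardsD1 [set x]) Px => -[].
split; last by rewrite inE setU11.
apply/stable_partitionsP.
have [Q_A Q_ind Q_k] := stable_partitionsP _ _ _ Q_st; split.
- by apply: partitionU1 => //; apply/set0Pn; exists x; rewrite set11.
- by move=> B /setU1P[->|/Q_ind//]; apply: independent1.
- by rewrite cardsU1 notin // Q_k.
Qed.

(* Such a partition arises from adjoining [x] to a block [B] of a partition of
   [A], and [(P, B)] is recovered by deleting [x] from its block. *)
Lemma stable_partitions_nonsingleton A k x : x \notin A ->
  #|stable_partitions (x |: A) k :\: [set P : {set {set G}} | [set x] \in P]| =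
  \sum_(P in stable_partitions A k) #|[set B in P | independent (x |: B)]|.
Proof.
move=> A'x.
pose D := [set PB : {set {set G}} * {set G} | [&& PB.1 \in stable_partitions A k,
  PB.2 \in PB.1 & independent (x |: PB.2)]].
pose add (PB : {set {set G}} * {set G}) := (x |: PB.2) |: (PB.1 :\ PB.2).
pose del (P : {set {set G}}) := let C := pblock P x in ((C :\ x) |: (P :\ C), C :\ x).
transitivity #|D|; last first.
  under [RHS]eq_bigr => P _ do rewrite -sum1dep_card.
  rewrite pair_big_dep -sum1dep_card; apply: eq_bigl => PB /=.
  by rewrite !inE.
have notin P B y : partition P A -> B \in P -> y \in B -> y != x.
  move=> P_A PB By; apply: contraNneq A'x => <-.
  exact: subsetP (partitionS P_A PB) _ By.
have add_partition P B : partition P A -> B \in P -> partition (add (P, B)) (x |: A).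
  move=> P_A PB; have -> : x |: A = (x |: B) :|: (A :\: B).
    apply/setP => y; rewrite !inE; have := subsetP (partitionS P_A PB) y.
    by case: (y \in B) => [->|_]; rewrite ?orbT ?orbF.
  apply: partitionU1; first exact: partitionD1.
    by apply/set0Pn; exists x; rewrite setU11.
  rewrite -setI_eq0; apply/eqP/setP => y; rewrite !inE.
  by case: eqP => [->|_]; rewrite ?(negPf A'x) ?andbF //=; case: (y \in B).
have addK : {in D, cancel add del}.
  move=> [P B]; rewrite inE => /and3P[/stable_partitionsP[P_A _ _] /= PB _].
  have P'_A := add_partition P B P_A PB.
  rewrite /del (def_pblock (partition_trivIset P'_A) (setU11 _ _) (setU11 _ _)).
  have B'x : x \notin B by apply/negP => /(notin P B x P_A PB); rewrite eqxx.
  rewrite /add /= setU1K // setU1K ?setD1K // !inE negb_and.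
  by apply/orP; right; apply/negP => /(notin P _ x P_A)/(_ (setU11 _ _)); rewrite eqxx.
rewrite -(card_in_imset (can_in_inj addK)); apply: eq_card => P.
apply/setDP/imsetP => [[/stable_partitionsP[P_xA P_ind P_k]]|[[Q B] QB_D ->]].
  rewrite inE => P'x; have P_triv := partition_trivIset P_xA.
  have Px : x \in cover P by rewrite (cover_partition P_xA) setU11.
  have Cx : x \in pblock P x by rewrite mem_pblock.
  have PC := pblock_mem Px.
  set C := pblock P x in Cx PC.
  (* As [[set x]] is not a block of [P], removing [x] from its block leaves a legitimate block. *)
  have C_neq : C :\ x != set0.
    by apply: contraNneq P'x => C0; rewrite -(setD1K Cx) C0 setU0 in PC.
  have dis : [disjoint C :\ x & (x |: A) :\: C].
    rewrite -setI_eq0; apply/eqP/setP => y; rewrite !inE.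
    by case: (y \in C); rewrite ?andbF.
  have P'Cx : C :\ x \notin P :\ C.
    apply/negP => /setD1P[neq_C PCx]; case/set0Pn: C_neq => y Cxy.
    have Cy : y \in C by move: Cxy; rewrite inE => /andP[].
    by case/eqP: neq_C; rewrite -(def_pblock P_triv PCx Cxy) (def_pblock P_triv PC Cy).
  exists (del P); last by rewrite /add /del /= -/C setU1K // !setD1K.
  rewrite inE /del /= -/C setU11 setD1K // P_ind // !andbT.
  apply/stable_partitionsP; split.
  - have -> : A = (C :\ x) :|: ((x |: A) :\: C).
      have sC := partitionS P_xA PC.
      apply/setP => y; rewrite !inE; case: (y =P x) => [->|/eqP neq_yx] /=.
        by rewrite Cx (negPf A'x).
      have := subsetP sC y; rewrite !inE (negPf neq_yx) /=.
      by case: (y \in C) => [->|].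
    by apply: partitionU1 => //; apply: partitionD1.
  - move=> B /setU1P[->|/setD1P[_ /P_ind//]].
    by apply: independent_sub (P_ind _ PC); apply: subsetDl.
  - by rewrite cardsU1 P'Cx -P_k [in RHS](cardsD1 C) PC.
move: QB_D; rewrite inE /= => /and3P[/stable_partitionsP[Q_A Q_ind Q_k] QB B_ind].
have B'x : x \notin B by apply/negP => /(notin Q B x Q_A QB); rewrite eqxx.
have Q'x (C : {set G}) : x \in C -> C \notin Q.
  by move=> Cx; apply/negP => /(notin Q _ x Q_A)/(_ Cx); rewrite eqxx.
split.
  apply/stable_partitionsP; split; first exact: add_partition.
    by move=> C /setU1P[->//|/setD1P[_ /Q_ind]].
  rewrite /add cardsU1 /= !inE (negPf (Q'x _ (setU11 _ _))) andbF.
  by rewrite -Q_k [in RHS](cardsD1 B) QB.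
(* The only block of [add (Q, B)] containing [x] is [x |: B]; were it [[set x]], the non-empty [B]
   would contain [x]. *)
rewrite !inE (negPf (Q'x _ (set11 _))) andbF orbF; apply: contraNneq B'x => xB.
have /set0Pn[y By] := partition_neq0 Q_A QB.
by have := setU1r x By; rewrite -xB => /set1P <-.
Qed.

(** Either [x] is a block by itself, or it joins one of the [k - #|N|] blocks free of its
    neighbours. *)
Lemma card_stable_partitionsU1 A x k
    (N : {set G} := [set y in A | adj x y]) :
  x \notin A -> clique N ->
  Posz #|stable_partitions (x |: A) k| =
  mul_root (fun j => Posz #|stable_partitions A j|) #|N| k.
Proof.
move=> A'x N_cl; rewrite -(cardsID [set P : {set {set G}} | [set x] \in P]).
rewrite stable_partitions_singleton // stable_partitions_nonsingleton //.
rewrite PoszD /mul_root; congr (_ + _)%R; first by case: k.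
(* The integer [k - #|N|] may be negative only when there is no partition to count; any [P0] shows
   [#|N| <= k], so truncated subtraction is exact. *)
have [->|/set0Pn[P0 P0_st]] := eqVneq (stable_partitions A k) set0.
  by rewrite cards0 big_set0 mulr0.
rewrite (eq_bigr (fun=> k - #|N|)) => [|P P_st].
  rewrite sum_nat_const mulnC PoszM subzn //.
  by rewrite -(card_free_blocks N_cl P0_st) leq_addl.
by rewrite -(card_free_blocks N_cl P_st) addnK.
Qed.

Lemma stable_partitions0 k : #|stable_partitions set0 k| = (k == 0).
Proof.
have [->|k_neq0] := eqVneq k 0.
  apply: etrans (cards1 (set0 : {set {set G}})); apply: eq_card => P; rewrite !inE.
  rewrite partition_set0; case: eqP => [->|//]; rewrite cards0 eqxx andbT.
  by apply/forall_inP => B; rewrite inE.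
apply: eq_card0 => P; rewrite !inE partition_set0; case: eqP => [->|//].
by rewrite cards0 eq_sym (negPf k_neq0) andbF.
Qed.

End StablePartitions.

(** * Back-degrees along a perfect elimination order *)

Section PerfectElimination.
Variables (G : sgraph) (n : nat) (v : 'I_n -> G).
Hypothesis v_peo : perfect_elimination_order v.

Definition back_nbhd (i : 'I_n) : {set G} :=
  [set v j | j : 'I_n & (j < i) && adj (v i) (v j)].

Definition back_degrees : seq nat := [seq #|back_nbhd i| | i : 'I_n].

Lemma peo_inj : injective v.
Proof. by case: v_peo => /bij_inj. Qed.

Lemma mem_back_nbhd i j : (v j \in back_nbhd i) = (j < i) && adj (v i) (v j).
Proof. by rewrite mem_imset ?inE //; apply: peo_inj. Qed.

Lemma mem_initial_segment m j : (v j \in initial_segment v m) = (j < m).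
Proof. by rewrite mem_imset ?inE //; apply: peo_inj. Qed.

Lemma initial_segmentS (i : 'I_n) :
  initial_segment v i.+1 = v i |: initial_segment v i.
Proof.
apply/setP => x; have [[w _ wK] _] := v_peo; rewrite -[x]wK.
rewrite in_setU1 !mem_initial_segment ltnS leq_eqVlt.
by rewrite (inj_eq peo_inj) val_eqE.
Qed.

Lemma back_nbhdE (i : 'I_n) :
  back_nbhd i = [set y in initial_segment v i | adj (v i) y].
Proof.
apply/setP => x; have [[w _ wK] _] := v_peo; rewrite -[x]wK.
by rewrite mem_back_nbhd in_set mem_initial_segment.
Qed.

Lemma size_back_degrees : size back_degrees = n.
Proof. by rewrite size_map size_enum_ord. Qed.

Lemma nth_back_degrees (i : 'I_n) : nth 0 back_degrees i = #|back_nbhd i|.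
Proof. by rewrite (nth_map i) ?size_enum_ord // nth_ord_enum. Qed.

(** Adjoining the vertex of index [m] multiplies the polynomial of the row by [x] minus its
    back-degree. *)
Lemma stirling_expansion m k : m <= n ->
  Posz #|stable_partitions (initial_segment v m) k| =
  expansion (take m back_degrees) k.
Proof.
elim: m k => [|m IHm] k le_m.
  rewrite take0 (_ : initial_segment v 0 = set0).
    by rewrite stable_partitions0 /expansion /=; case: eqP.
  by apply/setP => x; rewrite inE; apply/imsetP => -[j]; rewrite inE.
pose i := Ordinal le_m.
rewrite (take_nth 0) ?size_back_degrees // expansion_rcons.
rewrite -[m]/(val i) nth_back_degrees (initial_segmentS i).
rewrite card_stable_partitionsU1 -?back_nbhdE; last 2 first.
- by rewrite mem_initial_segment ltnn.
- exact: v_peo.2.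
by rewrite /mul_root !IHm 1?ltnW //; case: k => [|k]; rewrite ?IHm // ltnW.
Qed.

(* The latest back-neighbour of a vertex is adjacent to all the others, as the
   back-neighbours form a clique. *)
Lemma back_degree_growth (i : 'I_n) : 0 < #|back_nbhd i| ->
  exists2 j : 'I_n, j < i & #|back_nbhd i| <= #|back_nbhd j|.+1.
Proof.
case/card_gt0P => x0 /imsetP[j0]; rewrite inE => nb_j0 _ {x0}.
case: (arg_maxnP (P := [pred j : 'I_n | (j < i) && adj (v i) (v j)]) val nb_j0).
move=> j /= /andP[lt_ji adj_ij] max_j; exists j => //.
rewrite (cardsD1 (v j)) mem_back_nbhd lt_ji adj_ij /= add1n ltnS.
apply/subset_leq_card/subsetP => x; have [[w _ wK] _] := v_peo; rewrite -[x]wK.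
move: (w x) => l; rewrite in_setD1 (inj_eq peo_inj) !mem_back_nbhd.
case/andP=> neq_lj nb_l; have le_lj := max_j l nb_l.
rewrite ltn_neqAle neq_lj le_lj /=.
have /cliqueP nb_clique : clique (back_nbhd i) by apply: v_peo.2.
by apply: nb_clique; rewrite ?mem_back_nbhd ?lt_ji // (inj_eq peo_inj) eq_sym.
Qed.

Lemma restricted_growth_back_degrees : restricted_growth 0 back_degrees.
Proof.
(* Generalized to the terms from [m] on, with any [j] exceeding all earlier back-degrees;
   [back_degree_growth] then bounds the next one by [j]. *)
suff rg m j : m <= n -> (forall i : 'I_n, i < m -> #|back_nbhd i| < j) ->
    restricted_growth j (drop m back_degrees).
  by rewrite -[back_degrees]drop0; apply: rg.
move En: (n - m) => d; elim: d m j En => [|d IHd] m j En le_m lt_j.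
  by rewrite drop_oversize // size_back_degrees -subn_eq0 En.
have lt_m : m < n by lia.
pose i := Ordinal lt_m.
rewrite (drop_nth 0) ?size_back_degrees //= (nth_back_degrees i).
apply/andP; split.
  have [->//|] := posnP #|back_nbhd i|.
  by case/back_degree_growth => l lt_l le_i; apply: leq_trans le_i (lt_j l lt_l).
apply: IHd => // [|l]; first by lia.
rewrite ltnS leq_eqVlt leq_max => /predU1P[eq_l|/lt_j->//].
by rewrite (_ : l = i) ?leqnn ?orbT //; apply: val_inj.
Qed.

End PerfectElimination.

Theorem theorem2p2 (G : sgraph) (n : nat) (v : 'I_n -> G) :
  chordal G -> perfect_elimination_order v ->
  totally_nonneg (stirling_matrix v).
Proof.
move=> _ v_peo.
(* For [j = 0] the initial run is empty and the sequence is [back_degrees v] itself. *)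
have := @tn_expansion_restricted_growth n 0 (back_degrees v)
  (size_back_degrees v) (restricted_growth_back_degrees v_peo).
rewrite /tn_expansion /=; congr (totally_nonneg _); apply/matrixP => m k.
rewrite !mxE graph_stirling_induced stirling_expansion //.
by rewrite -ltnS.
Qed.
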